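(* Let $N,m,r$ be positive integers with $r\le m$, let $\Phi\in\mathbb{R}^{N\times m}$ have orthonormal columns, let $C\in\mathbb{R}^{r\times N}$ be a selection matrix, and let $\mathbf{y}=C\mathbf{u}\in\mathbb{R}^r$, where $\mathbf{u}\in\mathbb{R}^N$ satisfies $u_{\min}\le u_i\le u_{\max}$ for all $i$. Assume that $\Theta:=C\Phi\in\mathbb{R}^{r\times m}$ has full rank. Let $p:\mathbb{R}\to\mathbb{R}$ be an admissible penalty function for $[u_{\min},u_{\max}]$ and let $\mathcal{P}(\alpha)=\sum_{i=1}^N p([\Phi\alpha]_i)$ for $\alpha\in\mathbb{R}^m$. Then for any $\lambda>0$ and any minimizer $\alpha(\lambda)$ over $\mathbb{R}^m$ of $$f_\lambda(\alpha)=\tfrac12|\Theta\alpha-\mathbf{y}|^2+\lambda\,\mathcal{P}(\alpha),$$ the observation residual satisfies $$|\Theta\alpha(\lambda)-\mathbf{y}|\le\frac{\lambda}{\sigma_{\min}(\Theta)}\,|\nabla\mathcal{P}(\alpha(\lambda))|,$$ where $\sigma_{\min}(\Theta)$ is the smallest nonzero singular value of $\Theta$.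
   Context: $|\cdot|$ is the Euclidean norm and $[\Phi\alpha]_i$ is the $i$-th coordinate of $\Phi\alpha$. The bounds $u_{\min}\le u_{\max}$ are real numbers. A selection matrix $C\in\mathbb{R}^{r\times N}$ is a matrix whose rows are $r$ distinct rows of the $N\times N$ identity matrix. A function $p:\mathbb{R}\to\mathbb{R}$ is an admissible penalty function for $[u_{\min},u_{\max}]$ if: (1) $p$ is nonnegative, convex, twice continuously differentiable, $p''$ is Lipschitz continuous, and $p''(u)>0$ for all $u\notin[u_{\min},u_{\max}]$; (2) $p(u)=0$ for all $u\in[u_{\min},u_{\max}]$; (3) $p$ is monotonically decreasing for $u<u_{\min}$ and monotonically increasing for $u>u_{\max}$. *)

(* Defs.v *)
From HB Require Import structures.
From mathcomp Require Import all_boot all_order all_algebra.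
From mathcomp Require Import all_classical all_reals all_analysis.
Set Implicit Arguments.
Unset Strict Implicit.
Unset Printing Implicit Defensive.
Import Order.TTheory GRing.Theory Num.Theory.
Import numFieldNormedType.Exports.
Local Open Scope classical_set_scope.
Local Open Scope ring_scope.

(* The library norm [`|v|] on matrices is the sup norm, hence this definition. *)
Definition enorm (R : realType) (n : nat) (v : 'cV[R]_n) : R :=
  Num.sqrt (\sum_(i < n) v i 0 ^+ 2).

Definition grad (R : realType) (n : nat) (f : 'cV[R]_n -> R) (x : 'cV[R]_n) :
    'cV[R]_n :=
  \col_(j < n) 'D_(delta_mx j 0) f x.

Definition orthonormal_cols (R : realType) (N m : nat) (A : 'M[R]_(N, m)) : Prop :=
  A^T *m A = 1%:M.

Definition selection_matrix (R : realType) (r N : nat) (C : 'M[R]_(r, N)) : Prop :=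
  exists2 s : 'I_r -> 'I_N, injective s & C = rowsub s 1%:M.

Definition full_rank (R : realType) (r m : nat) (A : 'M[R]_(r, m)) : Prop :=
  \rank A = minn r m.

(* For a wide matrix 0 always satisfies this predicate, even when it is not one
   of the minn r m singular values; only nonzero values are used below. *)
Definition singular_value (R : realType) (r m : nat) (A : 'M[R]_(r, m)) (s : R) :
    Prop :=
  0 <= s /\ eigenvalue (A^T *m A) (s ^+ 2).

(* A matrix has finitely many singular values, so for [A != 0] this infimum is
   a minimum. *)
Definition sigma_min (R : realType) (r m : nat) (A : 'M[R]_(r, m)) : R :=
  inf [set s | singular_value A s /\ s != 0].

(* Monotonicity is non-strict; under the other conditions the strict version is
   equivalent, as p' = 0 on [umin, umax] and p'' > 0 outside. *)
Record admissible_penalty (R : realType) (umin umax : R) (p : R -> R) : Prop :=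
  AdmissiblePenalty {
    penalty_ge0 : forall u : R, 0 <= p u;
    penalty_convex : convex_function [set: R^o] p;
    penalty_derivable : forall u : R, derivable p u 1;
    penalty_derivable2 : forall u : R, derivable (p^`())%classic u 1;
    penalty_C2 : continuous (p^`(2))%classic;
    penalty_lipschitz2 : lipschitz (p^`(2))%classic;
    penalty_pos2 : forall u : R, u \notin `[umin, umax] -> 0 < (p^`(2))%classic u;
    penalty_eq0 : forall u : R, u \in `[umin, umax] -> p u = 0;
    penalty_decr : {in `]-oo, umin[ &, {homo p : u v / u <= v >-> v <= u}};
    penalty_incr : {in `]umax, +oo[ &, {homo p : u v / u <= v}}
  }.

Definition penalty (R : realType) (N m : nat) (Phi : 'M[R]_(N, m)) (p : R -> R)
    (a : 'cV[R]_m) : R :=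
  \sum_(i < N) p ((Phi *m a) i 0).

Definition objective (R : realType) (N m r : nat) (Phi : 'M[R]_(N, m))
    (C : 'M[R]_(r, N)) (y : 'cV[R]_r) (p : R -> R) (lambda : R)
    (a : 'cV[R]_m) : R :=
  2^-1 * enorm (C *m Phi *m a - y) ^+ 2 + lambda * penalty Phi p a.

Definition minimizer (R : realType) (T : Type) (f : T -> R) (x : T) : Prop :=
  forall y, f x <= f y.

(* Main.v *)
(** The first-order condition at a minimizer reads
    [Theta^T (Theta alpha - y) = - lambda grad P], so it suffices to have
    [sigma_min Theta * |e| <= |Theta^T e|] for every [e].  Since [Theta] has
    full row rank, the minimum [mu] of the Rayleigh quotient of
    [Theta Theta^T], attained on the compact unit sphere, is positive.
    [Theta Theta^T] and [Theta^T Theta] have the same nonzero eigenvalues, so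
    [sigma_min Theta] is the square root of [mu]. *)

Require Import Defs.
From HB Require Import structures.
From mathcomp Require Import all_boot all_order all_algebra.
From mathcomp Require Import ring lra.
From mathcomp Require Import all_classical all_reals all_analysis.
Import Order.TTheory GRing.Theory Num.Theory.
Import numFieldNormedType.Exports.
Local Open Scope classical_set_scope.
Local Open Scope ring_scope.

Set Implicit Arguments.
Unset Strict Implicit.

(** * Rayleigh quotients and the smallest singular value *)

Section Rayleigh.
Variable R : realType.
Implicit Types n k : nat.

(** Rows fit [eigenvalue], which is about left eigenvectors, and [EVT_min_rV]; the product form lets
    transposes be moved algebraically. *)
Definition sqnorm n (x : 'rV[R]_n) : R := (x *m x^T) 0 0.

Lemma sqnormE n (x : 'rV[R]_n) : sqnorm x = \sum_i x 0 i ^+ 2.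
Proof. by rewrite /sqnorm mxE; apply: eq_bigr => i _; rewrite mxE expr2. Qed.

Lemma sqnorm_ge0 n (x : 'rV[R]_n) : 0 <= sqnorm x.
Proof. by rewrite sqnormE sumr_ge0// => i _; exact: sqr_ge0. Qed.

Lemma sqnorm_eq0 n (x : 'rV[R]_n) : (sqnorm x == 0) = (x == 0).
Proof.
apply/idP/eqP => [|->]; last by rewrite /sqnorm mul0mx mxE.
rewrite sqnormE psumr_eq0; last by move=> i _; exact: sqr_ge0.
move=> /allP x0; apply/rowP => i; rewrite mxE; apply/eqP.
by have := x0 i (mem_index_enum i); rewrite /= sqrf_eq0.
Qed.

Lemma sqnormZ n (a : R) (x : 'rV[R]_n) : sqnorm (a *: x) = a ^+ 2 * sqnorm x.
Proof.
by rewrite /sqnorm linearZ /= -scalemxAr -scalemxAl scalerA mxE expr2.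
Qed.

Lemma sqnorm_enorm n (v : 'cV[R]_n) : enorm v ^+ 2 = sqnorm v^T.
Proof.
rewrite sqnormE sqr_sqrtr ?sumr_ge0// => [|i _]; last exact: sqr_ge0.
by apply: eq_bigr => i _; rewrite mxE.
Qed.

Lemma continuous_sqnormM n k (B : 'M[R]_(n, k)) :
  continuous (fun x : 'rV[R]_n => sqnorm (x *m B)).
Proof.
rewrite (_ : (fun _ => _) =
    (fun x : 'rV[R]_n => \sum_j (\sum_i x 0 i * B i j) ^+ 2)); last first.
  by apply/funext => z; rewrite sqnormE; apply: eq_bigr => j _; rewrite mxE.
apply: continuous_big => [|j _]; first exact: add_continuous.
move=> z; apply: (@continuous_comp _ _ _ _ (fun t : R => t ^+ 2)); last first.
  exact: exprn_continuous.
apply: continuous_big => [|i _]; first exact: add_continuous.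
move=> w; apply: (@continuous_comp _ _ _ (fun x : 'rV[R]_n => x 0 i)
    ( *%R^~ (B i j) : R -> R)).
  exact: coord_continuous.
exact: mulrr_continuous.
Qed.

Lemma psd_isotropic_ker n (M : 'M[R]_n) (x : 'rV[R]_n) : M^T = M ->
  (forall z : 'rV[R]_n, 0 <= (z *m M *m z^T) 0 0) ->
  (x *m M *m x^T) 0 0 = 0 -> x *m M = 0.
Proof.
move=> symM psdM qx0; apply/eqP; rewrite -sqnorm_eq0.
set z := x *m M; set q := (z *m M *m z^T) 0 0.
(* The form along the line [x + t z] is a quadratic polynomial in [t] with
   linear coefficient [2 |z|^2]; being nonnegative, it must have [z = 0]. *)
have qE (t : R) : ((x + t *: z) *m M *m (x + t *: z)^T) 0 0 =
    2 * t * sqnorm z + t ^+ 2 * q.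
  have zx : (z *m M *m x^T) 0 0 = sqnorm z.
    rewrite /sqnorm [in RHS]/z -[in RHS]mulmxA -[in RHS](trmxK (M *m z^T)).
    rewrite trmx_mul trmxK symM.
    rewrite -[in LHS](trmxK (z *m M)) -trmx_mul mxE; congr (_ _ _).
  rewrite !mulmxDl linearD /= linearZ /= !mulmxDr -!scalemxAl -!scalemxAr.
  have addE (A A' : 'M[R]_1) : (A + A') 0 0 = A 0 0 + A' 0 0 by rewrite mxE.
  have scaleE (a : R) (A : 'M[R]_1) : (a *: A) 0 0 = a * A 0 0 by rewrite mxE.
  rewrite !(addE, scaleE) qx0 zx -/z -/q -/(sqnorm z); ring.
have q_ge0 : 0 <= q by exact: psdM.
(* If [q = 0] the polynomial is linear and [t = -1] suffices. Otherwise the vertex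
   [t = - sqnorm z / q] gives the value [- sqnorm z ^+ 2 / q]. *)
have [q0|q_neq0] := eqVneq q 0.
  have := psdM (x + (-1) *: z); rewrite qE q0.
  have := sqnorm_ge0 z; lra.
have := psdM (x + (- (sqnorm z / q)) *: z); rewrite qE.
rewrite (_ : _ + _ = - (sqnorm z ^+ 2 / q)); last by field.
rewrite oppr_ge0 => h.
have h' : 0 <= sqnorm z ^+ 2 / q by rewrite divr_ge0// sqr_ge0.
have : sqnorm z ^+ 2 / q == 0 by rewrite eq_le h h'.
by rewrite mulf_eq0 invr_eq0 (negPf q_neq0) orbF sqrf_eq0.
Qed.

(** A minimizer [x] on the unit sphere makes the form of [B *m B^T - mu%:M] vanish, while minimality
    makes that form nonnegative. Thus [psd_isotropic_ker] yields the eigenvector equation without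
    Lagrange multipliers. *)
Lemma rayleigh_min n k (B : 'M[R]_(n, k)) : (0 < n)%N ->
  exists mu (x : 'rV[R]_n), [/\ x != 0, x *m B *m B^T = mu *: x &
    forall z : 'rV[R]_n, mu * sqnorm z <= sqnorm (z *m B)].
Proof.
move=> n_gt0; pose S := [set x : 'rV[R]_n | sqnorm x = 1].
have S0 : S !=set0.
  exists (delta_mx 0 (Ordinal n_gt0)); rewrite /S /= /sqnorm.
  by rewrite trmx_delta mul_delta_mx mxE !eqxx.
have cS : compact S.
  apply: bounded_closed_compact.
    (* Boundedness refers to the sup norm: each squared entry is at most the sum of squares, which
       is 1. *)
    exists 1; split => // M M1 x /= x1.
    rewrite [leLHS]mx_normrE; apply: bigmax_le; first by lra.
    move=> [i j] _ /=; rewrite (ord1 i).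
    apply: le_trans (ltW M1); rewrite -(@ler_pXn2r _ 2)// ?nnegrE// expr1n.
    rewrite real_normK ?num_real// -x1 sqnormE (bigD1 j)//= lerDl.
    by rewrite sumr_ge0// => k' _; exact: sqr_ge0.
  have -> : S = (fun x : 'rV[R]_n => sqnorm (x *m 1%:M)) @^-1` [set 1].
    by apply/seteqP; split => x; rewrite /S /= mulmx1.
  apply: preimage_closed; last exact: closed_eq.
  by move=> x _; exact: continuous_sqnormM.
have [c cS' cmin] := EVT_min_rV S0 cS
  (continuous_subspaceT (@continuous_sqnormM _ _ B)).
rewrite inE /S /= in cS'.
pose mu := sqnorm (c *m B).
have muP (z : 'rV[R]_n) : mu * sqnorm z <= sqnorm (z *m B).
  have [->|z0] := eqVneq z 0.
    by rewrite mul0mx /sqnorm !mul0mx !mxE mulr0.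
  have sz : 0 < sqnorm z by rewrite lt_neqAle sqnorm_ge0 eq_sym sqnorm_eq0 z0.
  (* By homogeneity it is enough to compare with the normalized vector. *)
  have := cmin ((Num.sqrt (sqnorm z))^-1 *: z).
  rewrite inE /S /= -scalemxAl !sqnormZ exprVn sqr_sqrtr ?sqnorm_ge0//.
  rewrite mulVf ?gt_eqF// => /(_ erefl).
  by rewrite mulrC ler_pdivlMr.
exists mu, c; split => //.
  by rewrite -sqnorm_eq0 cS' oner_eq0.
have qE (z : 'rV[R]_n) : (z *m (B *m B^T - mu%:M) *m z^T) 0 0 =
    sqnorm (z *m B) - mu * sqnorm z.
  rewrite mulmxBr mulmxBl mul_mx_scalar -scalemxAl /sqnorm trmx_mul !mulmxA.
  by rewrite [LHS]mxE; congr (_ + _); rewrite mxE [X in - X]mxE.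
apply/eqP; rewrite -subr_eq0 -mulmxA -mul_mx_scalar -mulmxBr; apply/eqP.
apply: psd_isotropic_ker.
- by rewrite linearB /= trmx_mul trmxK tr_scalar_mx.
- by move=> z; rewrite qE subr_ge0.
- by rewrite qE cS' mulr1 subrr.
Qed.

Lemma sigma_min_full_row_rank n k (A : 'M[R]_(n, k)) : (0 < n)%N ->
  \rank A = n ->
  0 < sigma_min A /\
  forall z : 'rV[R]_n, sigma_min A ^+ 2 * sqnorm z <= sqnorm (z *m A).
Proof.
move=> n_gt0 rA.
have freeA : row_free A by rewrite /row_free rA.
have kerA (z : 'rV[R]_n) : z *m A = 0 -> z = 0.
  by move=> zA; apply/eqP; rewrite -(mulmx_free_eq0 z freeA) zA.
have [mu [x [x0 xE muP]]] := rayleigh_min A n_gt0.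
have xA0 : x *m A != 0 by apply: contra x0 => /eqP/kerA ->.
have sqgt0 l (z : 'rV[R]_l) : z != 0 -> 0 < sqnorm z.
  by move=> z0; rewrite lt_neqAle sqnorm_ge0 eq_sym sqnorm_eq0 z0.
have muE : mu * sqnorm x = sqnorm (x *m A).
  by rewrite /sqnorm trmx_mul mulmxA xE -scalemxAl [RHS]mxE.
have mu_gt0 : 0 < mu by rewrite -(pmulr_lgt0 _ (sqgt0 _ _ x0)) muE sqgt0.
have smu : Num.sqrt mu ^+ 2 = mu by rewrite sqr_sqrtr// ltW.
(* Multiplying [x *m A *m A^T = mu *: x] by [A] shows that [x *m A] is an eigenvector of
   [A^T *m A]. *)
have mem : [set s | singular_value A s /\ s != 0] (Num.sqrt mu).
  split; last by rewrite gt_eqF// sqrtr_gt0.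
  split; first exact: sqrtr_ge0.
  apply/eigenvalueP; exists (x *m A) => //.
  by rewrite mulmxA xE -scalemxAl smu.
(* Conversely, an eigenvector [v] for [s ^+ 2] gives [w = v *m A^T], whose Rayleigh quotient is
   [s ^+ 2]; hence [mu <= s ^+ 2]. *)
have lb : lbound [set s | singular_value A s /\ s != 0] (Num.sqrt mu).
  move=> s [[s_ge0 /eigenvalueP[v vE v0]] s0].
  pose w := v *m A^T.
  have wA : w *m A = s ^+ 2 *: v by rewrite /w -mulmxA.
  have w0 : w != 0.
    apply: contra_neq v0 => w0.
    move: wA; rewrite w0 mul0mx => /esym/eqP.
    by rewrite scaler_eq0 sqrf_eq0 (negPf s0) => /eqP.
  have sE : sqnorm (w *m A) = s ^+ 2 * sqnorm w.
    rewrite /sqnorm trmx_mul mulmxA wA -[_ *m A^T]scalemxAl -/w -scalemxAl.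
    by rewrite [LHS]mxE.
  have := muP w; rewrite sE ler_pM2r ?sqgt0// => le_mu.
  by rewrite -(@ler_pXn2r _ 2)// ?nnegrE ?sqrtr_ge0// smu.
have -> : sigma_min A = Num.sqrt mu.
  apply/eqP; rewrite eq_le; apply/andP; split.
    by apply: ge_inf => //; exists (Num.sqrt mu).
  by apply: lb_le_inf => //; exists (Num.sqrt mu).
by rewrite smu sqrtr_gt0.
Qed.

End Rayleigh.

(** * The first-order condition at a minimizer *)

Section Stationarity.
Variable R : realType.

(** Reduces the entries of [grad] to one-variable derivatives, so that Fermat's rule on the real
    line is enough. *)
Lemma derive_line n (f : 'cV[R]_n -> R) (a v : 'cV[R]_n) :
  'D_v f a = 'D_1 (fun h : R => f (h *: v + a)) 0.
Proof.
rewrite /derive; set d := (X in lim (X @ _) = _).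
set d' := (X in _ = lim (X @ _)).
suff -> : d = d' by [].
apply/funext => h; rewrite /d /d' /=.
by rewrite addr0 scale0r add0r [h%:A]mulr1.
Qed.

Lemma derivable_penalty_line N n (Phi : 'M[R]_(N, n)) (p : R -> R)
    (a v : 'cV[R]_n) (t : R) : (forall u : R, derivable p u 1) ->
  derivable (fun h : R => penalty Phi p (h *: v + a)) t 1.
Proof.
move=> dp.
rewrite (_ : (fun h => _) = \sum_(i < N)
   (p \o (fun h : R => h * (Phi *m v) i 0 + (Phi *m a) i 0))); last first.
  apply/funext => h; rewrite fct_sumE; apply: eq_bigr => i _ /=.
  by rewrite mulmxDr -scalemxAr 2!mxE.
apply: derivable_sum => i.
apply/derivable1_diffP; apply: differentiable_comp; last first.
  by apply/derivable1_diffP.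
by apply/derivable1_diffP; apply: derivableD; [apply: derivableM|].
Qed.

Lemma sqr_enorm_line n (e w : 'cV[R]_n) (h : R) :
  enorm (h *: w + e) ^+ 2 =
    enorm e ^+ 2 + h * (2 * \sum_i w i 0 * e i 0) + h ^+ 2 * enorm w ^+ 2.
Proof.
rewrite !sqnorm_enorm !sqnormE !mulr_sumr -!big_split /=.
by apply: eq_bigr => i _; rewrite !mxE; ring.
Qed.

(** On each coordinate line through [a] the objective is a quadratic polynomial plus [lambda] times
    the penalty; its derivative vanishes at the minimum [h = 0], which is one coordinate of the
    equation. *)
Lemma minimizer_stationary N n r (Phi : 'M[R]_(N, n)) (C : 'M[R]_(r, N))
    (y : 'cV[R]_r) (p : R -> R) (lambda : R) (a : 'cV[R]_n) :
  (forall u : R, derivable p u 1) ->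
  minimizer (objective Phi C y p lambda) a ->
  (C *m Phi)^T *m (C *m Phi *m a - y) = - lambda *: grad (penalty Phi p) a.
Proof.
move=> dp amin; apply/colP => j; rewrite [RHS]mxE [X in _ * X]mxE derive_line.
set v := delta_mx j 0; set e := C *m Phi *m a - y.
set w := C *m Phi *m v; set P := fun h : R => penalty Phi p (h *: v + a).
have -> : ((C *m Phi)^T *m e) j 0 = \sum_i w i 0 * e i 0.
  rewrite mxE; apply: eq_bigr => i _; rewrite mxE; congr (_ * _).
  by rewrite /w /v -colE [RHS]mxE.
set b := \sum_i _.
(* As a formal polynomial, the quadratic part is differentiated by [deriv]; its derivative at 0 is
   [b]. *)
pose q : {poly R} :=
  (2^-1 * enorm e ^+ 2)%:P + b *: 'X + (2^-1 * enorm w ^+ 2) *: 'X^2.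
have gE : (fun h : R => objective Phi C y p lambda (h *: v + a)) =
    horner q + lambda \*: P.
  apply/funext => h; rewrite /objective mulmxDr -addrA -scalemxAr -/w -/e.
  have -> : (horner q + lambda \*: P) h = q.[h] + lambda * P h by [].
  by rewrite sqr_enorm_line -/b -/(P h) /q !hornerE /=; field.
have dP (t : R) : derivable P t 1 by exact: derivable_penalty_line.
have dg (t : R) : is_derive t 1 (horner q + lambda \*: P)
    ((deriv q).[t] + lambda *: 'D_1 P t).
  by apply: is_deriveD; apply: is_deriveZ; apply: derivableP.
have : is_derive (0 : R) 1 (horner q + lambda \*: P) 0.
  (* Any open interval around 0 would do. *)
  apply: (@derive1_at_min _ _ (-1) 1); first lra.
  - by move=> t _; have [] := dg t.
  - by rewrite in_itv /=; apply/andP; split; lra.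
  - by move=> t _; rewrite -gE scale0r add0r; exact: amin.
move=> /@derive_val; rewrite (@derive_val _ _ _ _ _ _ _ (dg 0)).
have -> : (deriv q).[0] = b.
  by rewrite /q !(derivD, derivC, derivZ, derivX, derivXn) !hornerE.
rewrite /GRing.scale /=; lra.
Qed.

End Stationarity.

Theorem theorem2 (R : realType) (N m r : nat)
    (N_gt0 : (0 < N)%N) (m_gt0 : (0 < m)%N) (r_gt0 : (0 < r)%N)
    (le_rm : (r <= m)%N)
    (umin umax : R) (le_u : umin <= umax)
    (Phi : 'M[R]_(N, m)) (Phi_orth : orthonormal_cols Phi)
    (C : 'M[R]_(r, N)) (C_sel : selection_matrix C)
    (u : 'cV[R]_N) (u_bnd : forall i, umin <= u i 0 <= umax)
    (y : 'cV[R]_r) (y_def : y = C *m u)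
    (Theta_full : full_rank (C *m Phi))
    (p : R -> R) (p_adm : admissible_penalty umin umax p)
    (lambda : R) (lambda_gt0 : 0 < lambda)
    (alpha : 'cV[R]_m)
    (alpha_min : minimizer (objective Phi C y p lambda) alpha) :
  enorm (C *m Phi *m alpha - y) <=
    lambda / sigma_min (C *m Phi) * enorm (grad (penalty Phi p) alpha).
Proof.
have rT : \rank (C *m Phi) = r by rewrite Theta_full; apply/minn_idPl.
have [s_gt0 sP] := sigma_min_full_row_rank r_gt0 rT.
have st := minimizer_stationary (penalty_derivable p_adm) alpha_min.
set e := C *m Phi *m alpha - y in st *; set G := grad _ _ in st *.
(* The denominator is cleared and both nonnegative sides are squared, to match [sP]. *)
rewrite mulrAC ler_pdivlMr// -(@ler_pXn2r _ 2)// ?nnegrE;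
  do ?by rewrite mulr_ge0 ?sqrtr_ge0 ?(ltW s_gt0) ?(ltW lambda_gt0).
(* The row [e^T *m (C *m Phi)] is the transpose of [- lambda *: G]; squaring removes the sign. *)
have := sP e^T; rewrite -[e^T *m _]trmxK trmx_mul trmxK st linearZ /= sqnormZ.
by rewrite (sqrrN lambda) -!sqnorm_enorm !exprMn mulrC.
Qed.
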